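(* Let $d_1\le\ldots\le d_k$ be positive integers, let $\alpha=(\alpha_{d_1},\ldots,\alpha_{d_k})\in\mathbb{N}_0^k$ with $r=\alpha_{d_1}+\ldots+\alpha_{d_k}$, and let $f_1,\ldots,f_r\in\mathbb{C}[x_1,\ldots,x_n]$ be a general sequence of forms of type $\alpha$. Let $I=(f_1,\ldots,f_r)$ and let $\ell\in\mathbb{N}$. Then the vector space $(f_1,\ldots,f_r)_{d_k+\ell}$ has the expected dimension, i.e. $$h_I(d_k+\ell)=\alpha_{d_k}N_{\ell}+\alpha_{d_{k-1}}N_{\ell+(d_k-d_{k-1})}+\ldots+\alpha_{d_1}N_{\ell+d_k-d_1},$$ if for all $i=1,\ldots,k$ we have $$\alpha_{d_1}N_{\ell+d_k-d_1}+\ldots+\alpha_{d_i}N_{\ell+d_k-d_i}+N_{\ell+d_k-d_1}\,(N_{\ell+d_k-d_i}-1)<N_{\ell+d_k}.$$ Otherwise, if $$\alpha_{d_1}N_{\ell+d_k-d_1}+\ldots+\alpha_{d_k}N_{\ell}>N_{\ell+d_k}+k\,N_{\ell+d_k-d_1}\,(N_{\ell+d_k-d_1}-1),$$ then $(f_1,\ldots,f_r)_{d_k+\ell}=\mathbb{C}[x_1,\ldots,x_n]_{d_k+\ell}$.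
   Context: $N_t=\binom{n+t-1}{t}$ is the dimension of the space $\mathbb{C}[x_1,\ldots,x_n]_t$ of forms of degree $t$ in $n$ variables. For a homogeneous ideal $I$, $I_t$ denotes its graded component of degree $t$, and the Hilbert function is $h_I(t):=\dim I_t$. A general sequence of forms of type $\alpha$ consists of $r$ general forms, of which $\alpha_{d_i}$ (the $i$-th entry of $\alpha$) have degree $d_i$ for each $i\in\{1,\ldots,k\}$. *)

(* Defs.v *)
From HB Require Import structures.
From mathcomp Require Import all_boot all_order all_algebra.
From mathcomp Require Import boolp classical_sets.
From mathcomp Require Import mpoly.

Set Implicit Arguments.
Unset Strict Implicit.
Unset Printing Implicit Defensive.

Import Order.TTheory GRing.Theory Num.Theory.
Local Open Scope ring_scope.
Local Open Scope classical_set_scope.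

Definition Ndim (n t : nat) : nat := 'C(n + t - 1, t).

(* The library makes [dhomog m F t], the type of forms of degree [t] in [m]
   variables, a finite-dimensional vector space only when [m] is a successor. *)
Lemma dim_forms (F : fieldType) (n t : nat) :
  \dim (fullv : {vspace dhomog n.+1 F t}) = Ndim n.+1 t.
Proof. by rewrite dimvf /dim /= /Ndim addSn subn1 /= addnC. Qed.

Section Ideals.
Context {F : fieldType} {n : nat}.

Definition ideal {J : finType} (f : J -> {mpoly F[n]}) : set {mpoly F[n]} :=
  [set p | exists g : J -> {mpoly F[n]}, p = \sum_j g j * f j].

End Ideals.

Section Components.
Context {F : fieldType} {n : nat}.

(* The subspace of all forms of degree [t] lying in [I].  The default value of
   [xget] is used only when these forms are not a subspace, which does not
   happen when [I] is an ideal: see [mem_component]. *)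
Definition component (I : set {mpoly F[n.+1]}) (t : nat) :
    {vspace dhomog n.+1 F t} :=
  xget 0%VS [set V : {vspace dhomog n.+1 F t} |
    forall p : dhomog n.+1 F t, (p \in V) <-> I p].

Definition hilbert (I : set {mpoly F[n.+1]}) (t : nat) : nat :=
  \dim (component I t).

Lemma mem_component (J : finType) (f : J -> {mpoly F[n.+1]}) (t : nat)
    (p : dhomog n.+1 F t) :
  (p \in component (ideal f) t) <-> ideal f p.
Proof.
suff [V VP] : exists V : {vspace dhomog n.+1 F t},
    forall q : dhomog n.+1 F t, (q \in V) <-> ideal f q.
  by rewrite /component; case: xgetP => [W _ /(_ p)|/(_ V)].
have iD (u v : {mpoly F[n.+1]}) : ideal f u -> ideal f v -> ideal f (u + v).
  move=> [g ->] [h ->]; exists (fun j => g j + h j).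
  by rewrite -big_split /=; apply: eq_bigr => j _; rewrite mulrDl.
have iZ (c : F) (u : {mpoly F[n.+1]}) : ideal f u -> ideal f (c *: u).
  move=> [g ->]; exists (fun j => c *: g j).
  by rewrite scaler_sumr; apply: eq_bigr => j _; rewrite scalerAl.
have i0 : ideal f 0.
  by exists (fun=> 0); rewrite big1 // => j _; rewrite mul0r.
pose sub (V : {vspace dhomog n.+1 F t}) := forall q, q \in V -> ideal f (val q).
pose P m := `[< exists2 V, sub V & \dim V = m >].
have exP : exists m, P m.
  by exists 0; apply/asboolP; exists 0%VS; rewrite ?dimv0 // => q;
    rewrite memv0 => /eqP ->.
have ubP m : P m -> (m <= \dim (fullv : {vspace dhomog n.+1 F t}))%N.
  by move=> /asboolP[V _ <-]; apply: dimvS; exact: subvf.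
have [m /asboolP[V sV dV] maxm] := ex_maxnP exP ubP.
exists V => q; split => [/sV//|iq].
have sW : sub (V + <[q]>)%VS.
  move=> u /memv_addP[v vV [w /vlineP[c ->] ->]].
  by apply: iD; [exact: sV | exact: iZ].
have /maxm leW : P (\dim (V + <[q]>)%VS) by apply/asboolP; exists (V + <[q]>)%VS.
have /eqP -> : V == (V + <[q]>)%VS by rewrite eqEdim addvSl dV.
by apply: (subvP (addvSr V <[q]>)); exact: memv_line.
Qed.

End Components.

(* Families of forms f_j of prescribed degrees e_j are the points of an affine
   space, whose coordinates are the coefficients of the f_j. *)
Section Generality.
Context {F : fieldType} {n : nat} {J : finType} {e : J -> nat}.

Definition forms := forall j : J, dhomog n F (e j).

Definition coef_index :=
  {j : J & {m : 'X_{1..n < (e j).+1} | mdeg m == e j}}.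

Definition coefs (f : forms) (c : 'I_#|{: coef_index}|) : F :=
  let s := enum_val c in (f (tag s) : {mpoly F[n]})@_(val (tagged s)).

Definition zariski_closed (Z : set forms) : Prop :=
  exists S : set {mpoly F[#|{: coef_index}|]},
    Z = [set f | forall P, S P -> P.@[coefs f] = 0].

Definition zariski_open (U : set forms) : Prop := zariski_closed (~` U).

(* "A general family of forms satisfies P"; over an infinite field a nonempty
   open set is dense, since affine space is irreducible. *)
Definition general (P : set forms) : Prop :=
  exists U : set forms, [/\ zariski_open U, U !=set0 & U `<=` P].

End Generality.

Arguments forms F n {J} e.

(* Sequences of type alpha are indexed by the pairs (i, j) with j < alpha_i,
   and the form of index (i, j) has degree d_i. *)
Definition type_index {k : nat} (alpha : 'I_k -> nat) : finType :=
  {i : 'I_k & 'I_(alpha i)}.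

Definition type_deg {k : nat} (d alpha : 'I_k -> nat) (s : type_index alpha) :
  nat := d (tag s).

(* Main.v *)
(* Let V be the degree-t part of the ideal of general forms h_1, ..., h_m, the
   h_i having degree e_i.  Since V has maximal dimension, moving the h_i to
   first order shows that a relation \sum_i g_i h_i = 0 forces g_i S_{e_i} <= V
   for all i, where S_a is the space of forms of degree a.  Let d be the least
   of the degrees and J = {g in S_{t-d} | g S_d <= V}.  Suppose that adding a
   further general form h of degree a makes the dimension of V grow by less than
   dim S_{t-a}, so that some nonzero c in S_{t-a} has c h = \sum_i g_i h_i, and
   that J does not grow.  Then c and the g_i multiply all forms into V, and
   applying x_i d/dx_j to this identity gives x_i dc/dx_j h in V.  Hence the
   space of these c is stable under the linear group; as S_{t-a} is irreducible
   every c occurs, and the enlarged V is all of S_t.  So from the first deficient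
   form of degree a on, J grows with every further form of degree a until V is
   full, which takes at most dim S_{t-d} steps, each of which contributes at most
   dim S_{t-a} - 1 dimensions.  Both claims follow by counting. *)
Require Import Defs.
From HB Require Import structures.
From mathcomp Require Import all_boot all_order all_algebra.
From mathcomp Require Import boolp classical_sets reals.
From mathcomp Require Import complex mpoly zify.

Set Implicit Arguments.
Unset Strict Implicit.
Unset Printing Implicit Defensive.

Import Order.TTheory GRing.Theory Num.Theory.
Local Open Scope ring_scope.

(** * Linear algebra at points of maximal rank *)

Lemma poly_nonroot (F : numDomainType) (p : {poly F}) :
  p != 0 -> exists2 x, x != 0 & p.[x] != 0.
Proof.
move=> p0; pose s := [seq (i.+1)%:R : F | i <- iota 0 (size p)].
have us : uniq s.
  by rewrite map_inj_uniq ?iota_uniq // => i j /eqP; rewrite eqr_nat => /eqP [].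
have : ~~ all (root p) s.
  apply/negP => rs; have := max_poly_roots p0 rs us.
  by rewrite size_map size_iota ltnn.
by move=> /allPn[_ /mapP[i _ ->] r]; exists i.+1%:R; rewrite ?pnatr_eq0.
Qed.

(** The determinant of [x%:M + M] is the characteristic polynomial of [- M] at [x], which has a
    nonzero nonroot [x]; dividing by [x] gives the perturbation. *)
Lemma unitmx_perturb (F : numFieldType) n (M : 'M[F]_n) :
  exists2 x, x != 0 & 1%:M + x *: M \in unitmx.
Proof.
have := monic_neq0 (char_poly_monic (- M)) => /poly_nonroot[x x0 px].
exists x^-1; rewrite ?invr_eq0 //.
have -> : 1%:M + x^-1 *: M = x^-1 *: (x%:M + M).
  by rewrite scalerDr scale_scalar_mx mulVf.
rewrite unitmxZ ?unitfE ?invr_eq0 // unitmxE unitfE.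
rewrite /char_poly -horner_evalE -det_map_mx in px.
suff -> : x%:M + M = map_mx (horner_eval x) (char_poly_mx (- M)) by [].
apply/matrixP => i j; rewrite !mxE /horner_eval !hornerE opprK.
by case: (i == j); rewrite ?mulr1n ?mulr0n !hornerE.
Qed.

Section MatrixEncodings.
Import VectorInternalTheory.

Lemma lfun_perturb_inj (F : numFieldType) (W : vectType F) (phi : 'End(W)) :
  exists2 x, x != 0 & lker (\1 + x *: phi)%VF = 0%VS.
Proof.
pose M := f2mx phi.
have [x x0 ux] := unitmx_perturb M; exists x => //; apply/eqP/lker0P => a b.
rewrite !add_lfunE !scale_lfunE !id_lfunE => ab.
apply: v2r_inj; apply: (can_inj (mulmxK ux)).
have E v : v2r v *m (1%:M + x *: M) = v2r (v + x *: phi v).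
  by rewrite mulmxDr mulmx1 -scalemxAr linearD linearZ /= [in RHS]unlock r2vK.
by rewrite !E ab.
Qed.

Lemma dim_span_rank (F : fieldType) (W : vectType F) m (x : 'I_m -> W) :
  \dim <<[seq x i | i : 'I_m]>> = \rank (\matrix_i v2r (x i)).
Proof.
have -> : [seq x i | i : 'I_m] = [tuple x i | i < m] by [].
have -> : \matrix_i v2r (x i) = b2mx [tuple x i | i < m].
  by apply/matrixP => i j; rewrite !mxE tnth_mktuple.
move: [tuple x i | i < m] => X.
have -> : <<X>>%VS = mx2vs (b2mx X) by rewrite unlock tvalK; case: _ / (esym _).
by rewrite /dimv (mx2vsK _).
Qed.

(* If [L] and [R] are such that [L *m A a0 *m R] is the identity of size
   [\rank (A a0)], then [P] is the determinant of [L *m A *m R]. *)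
Lemma rank_open (F : fieldType) (W : vectType F) M m
    (x : 'I_M -> 'I_m -> W) (a0 : 'I_M -> F)
    (xa := fun (a : 'I_M -> F) i => \sum_c a c *: x c i) :
  exists2 P : {mpoly F[M]}, P.@[a0] != 0 &
    forall a, P.@[a] != 0 ->
      (\dim <<[seq xa a0 i | i : 'I_m]>> <= \dim <<[seq xa a i | i : 'I_m]>>)%N.
Proof.
pose A (a : 'I_M -> F) := \matrix_i v2r (xa a i).
have [L LE] := row_fullP (col_base_full (A a0)).
have [R RE] := row_freeP (row_base_free (A a0)).
pose Ap := \sum_c 'X_c *: map_mx (@mpolyC M F) (\matrix_i v2r (x c i)).
have ApE a : map_mx (meval a) Ap = A a.
  apply/matrixP => i j; rewrite !mxE summxE rmorph_sum /= linear_sum /= summxE.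
  apply: eq_bigr => c _.
  by rewrite linearZ !mxE mevalM mevalXU mevalC.
pose P := \det (map_mx (@mpolyC M F) L *m Ap *m map_mx (@mpolyC M F) R).
have mK p q (B : 'M[F]_(p, q)) a : map_mx (meval a) (map_mx (@mpolyC M F) B) = B.
  by apply/matrixP => i j; rewrite !mxE mevalC.
have PE a : P.@[a] = \det (L *m A a *m R).
  by rewrite -[P.@[a]]/(meval a P) -det_map_mx !map_mxM !mK ApE.
exists P => [|a].
  have -> : P.@[a0] = \det (L *m (col_base (A a0) *m row_base (A a0)) *m R).
    by rewrite PE mulmx_base.
  by rewrite mulmxA LE mul1mx RE det1 oner_neq0.
rewrite PE -unitfE -unitmxE => /mxrank_unit rkE; rewrite !dim_span_rank -/(A a0).
rewrite -{1}rkE; apply: leq_trans (mxrankM_maxl _ _) _; exact: mxrankM_maxr.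
Qed.

End MatrixEncodings.

(* If [w := \sum_i u i *: y i] were not in the span [X] of the [x i], then for
   some [c <> 0] the span of the [x i + c *: y i] would contain an injective
   image of [X + <w>]. *)
Lemma max_rank_tangent (F : numFieldType) (W : vectType F) m
    (x y : 'I_m -> W) (u : 'I_m -> F) :
  (forall c : F, \dim <<[seq (x i + c *: y i)%R | i : 'I_m]>>
             <= \dim <<[seq x i | i : 'I_m]>>)%N ->
  \sum_i u i *: x i = 0 -> \sum_i u i *: y i \in <<[seq x i | i : 'I_m]>>%VS.
Proof.
move=> maxx ux0; pose X := [tuple x i | i < m].
have XE : [seq x i | i : 'I_m] = X by [].
rewrite XE in maxx *; set w := \sum_i _; apply/negPn/negP => wX.
have capXw : (<<X>> :&: <[w]> = 0)%VS.
  apply/eqP; rewrite -subv0; apply/subvP => a; rewrite memv_cap => /andP[aX].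
  move=> /vlineP[c aE]; move: aX; rewrite aE memv0.
  have [->|c0] := eqVneq c 0; first by rewrite scale0r.
  by move=> /(memvZ c^-1); rewrite scalerA mulVf // scale1r (negPf wX).
pose pi := daddv_pi <<X>> <[w]>.
have piw : pi w = 0.
  have := @daddv_pi_add _ _ <<X>>%VS <[w]>%VS w capXw.
  rewrite (subvP (addvSr _ _)) ?memv_line // => /(_ isT).
  rewrite (daddv_pi_id _ (memv_line w)) 1?capvC // => piw.
  by apply: (addIr w); rewrite add0r.
(* On [<<X>>], [phi0] replaces each [x i] by [y i] in chosen coordinates, and it kills [w]. So
   [\1 + c *: phi0] maps [<<X>>] into the span of the [x i + c *: y i] and fixes [w], which by the
   relation [u] equals [c^-1 *: \sum_i u i *: (x i + c *: y i)]. *)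
pose phi0 a : W := \sum_i coord X i (pi a) *: y i.
have phi0_lin : linear phi0.
  move=> c a b; rewrite /phi0 scaler_sumr -big_split /=; apply: eq_bigr => i _.
  by rewrite !linearP scalerDl scalerA.
pose phiL := GRing.isLinear.Build _ _ _ _ phi0 phi0_lin.
pose phi1 : {linear W -> W} := HB.pack phi0 phiL.
have [c c0 kc] := lfun_perturb_inj (linfun phi1).
set g := (_ + _)%VF in kc.
have gE a : g a = a + c *: phi0 a.
  by rewrite add_lfunE scale_lfunE id_lfunE lfunE.
have sub : (g @: (<<X>> + <[w]>) <= <<[seq (x i + c *: y i)%R | i : 'I_m]>>)%VS.
  apply/subvP => _ /memv_imgP[_ /memv_addP[a aX [_ /vlineP[k ->] ->]] ->].
  have memxy (v : 'I_m -> F) :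
      \sum_i v i *: (x i + c *: y i) \in <<[seq (x i + c *: y i)%R | i : 'I_m]>>%VS.
    apply: memv_suml => i _; apply/memvZ/memv_span.
    by apply: (map_f (fun i => x i + c *: y i)); rewrite mem_enum.
  rewrite linearD linearZ /= memvD ?memvZ //.
    rewrite gE /phi0 /pi daddv_pi_id // {1}(coord_span aX) scaler_sumr.
    rewrite -big_split /=.
    under eq_bigr => i _ do
      rewrite (nth_map i) ?size_enum_ord // nth_ord_enum scalerA mulrC -scalerA -scalerDr.
    exact: memxy.
  rewrite gE /phi0 piw big1 => [|i _]; last by rewrite linear0 scale0r.
  rewrite scaler0 addr0; have := memvZ c^-1 (memxy u).
  under eq_bigr do rewrite scalerDr scalerA mulrC -scalerA.
  by rewrite big_split /= ux0 add0r -scaler_sumr scalerA mulVf // scale1r.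
have := leq_trans (dimvS sub) (maxx c).
rewrite limg_dim_eq ?kc ?capv0 // dimv_disjoint_sum // dim_vline.
have -> : w != 0 by apply: contraNneq wX => ->; rewrite mem0v.
by rewrite addn1 ltnn.
Qed.

Lemma meval_line (F : comNzRingType) M (P : {mpoly F[M]}) (a b : 'I_M -> F) :
  exists p : {poly F}, forall c, p.[c] = P.@[fun i => a i + c * b i].
Proof.
exists (mmap (@polyC F) (fun i => (a i)%:P + 'X * (b i)%:P) P) => c.
rewrite mevalE /mmap horner_sum; apply: eq_bigr => m _.
rewrite hornerM hornerC; congr (_ * _).
rewrite /mmap1 horner_prod; apply: eq_bigr => i _.
by rewrite horner_exp !hornerE.
Qed.

(** On the line through [a] and [b], [P] is nonzero at parameter 0 and [Q] at parameter 1, so both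
    restrict to nonzero univariate polynomials. This is the irreducibility of affine space, needed
    to impose finitely many open conditions at once. *)
Lemma meval_common_nonroot (F : numFieldType) M (P Q : {mpoly F[M]})
    (a b : 'I_M -> F) :
  P.@[a] != 0 -> Q.@[b] != 0 ->
  exists c : F, (P * Q).@[fun i => a i + c * (b i - a i)] != 0.
Proof.
move=> Pa Qb; have [p pE] := meval_line (P * Q) a (fun i => b i - a i).
have [p1 p1E] := meval_line P a (fun i => b i - a i).
have [p2 p2E] := meval_line Q a (fun i => b i - a i).
have : p1 * p2 != 0.
  rewrite mulf_neq0 //.
    apply: contraNneq Pa => p0; have := p1E 0; rewrite p0 horner0 => /esym/eqP.
    by under meval_eq => i do rewrite mul0r addr0.
  apply: contraNneq Qb => p0; have := p2E 1; rewrite p0 horner0 => /esym/eqP.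
  by under meval_eq => i do rewrite mul1r addrC subrK.
move=> /poly_nonroot[c _ pc]; exists c; move: pc.
by rewrite hornerM p1E p2E mevalM.
Qed.

(** * Polarization operators *)

Section Homogeneous.
Variables (F : fieldType) (n : nat).
Implicit Types (p q : {mpoly F[n]}) (m : 'X_{1..n}).

Lemma indhomogK t p : p \is t.-homog -> val (indhomog t p) = p.
Proof. by move=> hp; rewrite val_insubd hp. Qed.

Lemma dhomog_monomial m : 'X_[m] \is [in F[n], (mdeg m).-homog].
Proof. by rewrite dhomogX. Qed.

Lemma dhomog_expand t p : p \is t.-homog ->
  p = \sum_(m <- msupp p | mdeg m == t) p@_m *: 'X_[m].
Proof.
move=> /dhomogP hp; rewrite {1}[p]mpolyE big_seq_cond [RHS]big_seq_cond.
by apply: eq_bigl => m; case: (boolP (m \in _)) => //= /hp ->; rewrite eqxx.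
Qed.

Lemma mnm_le_mdeg m i : (m i <= mdeg m)%N.
Proof. by rewrite mdegE (bigD1 i) //= leq_addr. Qed.

Lemma mnm_split a b m : mdeg m = (a + b)%N ->
  exists m1 m2, [/\ m = (m1 + m2)%MM, mdeg m1 = a & mdeg m2 = b].
Proof.
elim: a m => [|a IH] m dm; first by exists 0%MM, m; rewrite add0m mdeg0.
have [i mi] : exists i, m i != 0%N.
  apply/existsP; rewrite -negb_forall; apply/negP => /forallP m0.
  move: dm; rewrite mdegE big1 // => i _; by apply/eqP.
have mE : m = (m - U_(i) + U_(i))%MM by rewrite submK // lep1mP.
have /IH[m1 [m2 [m'E d1 d2]]] : mdeg (m - U_(i)) = (a + b)%N.
  by move: dm; rewrite {1}mE mdegD mdeg1 addn1 addSn => -[].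
exists (m1 + U_(i))%MM, m2; split => //; last by rewrite mdegD mdeg1 addn1 d1.
by rewrite mE m'E -!addmA [(m2 + _)%MM]addmC.
Qed.

(** Each monomial of degree [a + b] splits into monomials of degrees [a] and [b], so a linear
    property need only be checked on products. *)
Lemma dhomogD_ind a b (Q : {mpoly F[n]} -> Prop) :
  Q 0 -> (forall c p q, Q p -> Q q -> Q (c *: p + q)) ->
  (forall p q, p \is (a).-homog -> q \is b.-homog -> Q (p * q)) ->
  forall p, p \is (a + b).-homog -> Q p.
Proof.
move=> Q0 QD QM p /dhomog_expand ->.
elim/big_rec: _ => // m q /eqP dm Qq; apply: QD => //.
have [m1 [m2 [-> d1 d2]]] := mnm_split dm.
by rewrite mpolyXD; apply: QM; rewrite -?d1 -?d2 dhomog_monomial.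
Qed.

Definition polarize (i j : 'I_n) p : {mpoly F[n]} := 'X_i * p^`M(j).

Lemma polarize_homog i j t p : p \is t.-homog -> polarize i j p \is t.-homog.
Proof.
move=> /dhomog_expand ->; rewrite /polarize linear_sum /= mulr_sumr.
apply: rpred_sum => m /eqP dm; rewrite linearZ /= -scalerAr mderivX.
have [->|mj] := eqVneq (m j) 0%N; first by rewrite scale0r mulr0 scaler0 rpred0.
rewrite -scalerAr -mpolyXD !rpredZ // dhomogX; apply/eqP.
have mE : m = (m - U_(j) + U_(j))%MM by rewrite submK // lep1mP.
by rewrite -[LHS]/(mdeg _) -dm [in RHS]mE !mdegD !mdeg1 addnC.
Qed.

Fact polarize_is_linear i j : linear (polarize i j).
Proof. by move=> c p q; rewrite /polarize linearP mulrDr scalerAr. Qed.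

HB.instance Definition _ i j :=
  GRing.isLinear.Build _ _ _ _ (polarize i j) (polarize_is_linear i j).

Lemma polarizeM i j p q :
  polarize i j (p * q) = polarize i j p * q + p * polarize i j q.
Proof. by rewrite /polarize mderivM mulrDr [p * (_ * _)]mulrCA !mulrA. Qed.

End Homogeneous.

(* The operators [x_i d/dx_j] span the Lie algebra of the linear group, for
   which the forms of a given degree are an irreducible representation. *)
Section Irreducible.
Variables (F : numFieldType) (n a : nat).
Local Notation S := (dhomog n.+1 F a).
Variable W : {vspace S}.
Hypothesis W_stable : forall i j (w v : S),
  w \in W -> val v = polarize i j (val w) -> v \in W.

Let mono (m : 'X_{1..n.+1}) : S := indhomog a 'X_[m].

Let val_mono m : mdeg m = a -> val (mono m) = 'X_[m].
Proof. by move=> dm; rewrite indhomogK // -dm dhomog_monomial. Qed.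

Let expand (v : S) : v = \sum_(m <- msupp (val v) | mdeg m == a) (val v)@_m *: mono m.
Proof.
apply: val_inj; rewrite {1}(dhomog_expand (dhomog_is_dhomog v)) raddf_sum /=.
by apply: eq_bigr => m /eqP dm; rewrite val_mono.
Qed.

(** This produces a highest weight vector. For [j != ord0], [polarize ord0 j] raises the exponent of
    ['X_ord0] in every surviving monomial; that exponent is at most [a], so repeated application
    must stop at a nonzero form with vanishing derivatives. *)
Lemma polarize_kernel : W != 0%VS ->
  exists w : S, [/\ w \in W, w != 0 &
    forall j, j != ord0 -> (val w)^`M(j) = 0].
Proof.
rewrite -vpick0 => w0.
suff H s : (exists w : S, [/\ w \in W, w != 0 &
       forall m, m \in msupp (val w) -> (s <= m ord0)%N]) \/
    exists w : S, [/\ w \in W, w != 0 & forall j, j != ord0 -> (val w)^`M(j) = 0].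
  have [[w [_ wn0 ws]]|//] := H a.+1.
  have lw : mlead (val w) \in msupp (val w) by rewrite mlead_supp.
  have dl : mdeg (mlead (val w)) = a.
    exact: dhomog_mf (dhomog_is_dhomog w) _ lw.
  by have := leq_trans (ws _ lw) (mnm_le_mdeg _ _); rewrite dl ltnn.
elim: s => [|s [[w [wW wn0 ws]]|]]; [|
  |by right].
  by left; exists (vpick W); split; rewrite ?memv_pick.
have [|/existsNP[j /not_implyP[j0 /eqP dw]]] :=
  pselect (forall j, j != ord0 -> (val w)^`M(j) = 0).
  by right; exists w.
left; have hv : polarize ord0 j (val w) \is (a).-homog.
  exact/polarize_homog/dhomog_is_dhomog.
exists (indhomog a (polarize ord0 j (val w))); split.
- by apply: (@W_stable ord0 j w) => //; rewrite indhomogK.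
- apply: contraNneq dw => /(congr1 val); rewrite indhomogK // => /eqP.
  by rewrite mulf_eq0 => /orP[|//]; rewrite -msupp_eq0 msuppX.
- move=> m; rewrite indhomogK // /polarize mulrC.
  rewrite (perm_mem (msuppMX _ _)) => /mapP[m' m'w ->].
  have : (m' + U_(j))%MM \in msupp (val w).
    move: m'w; rewrite !mcoeff_msupp mcoeff_mderiv; apply: contraNneq => ->.
    by rewrite mul0rn.
  by move=> /ws; rewrite !mnmDE !mnm1E eqxx (negPf j0) /= addn0 add1n ltnS.
Qed.

(** Induction on the degree in the variables other than ['X_ord0]: trading one ['X_i] of [m] for
    ['X_ord0] gives [m'], and [polarize i ord0] sends [m'] back to a multiple of [m], nonzero in
    characteristic zero. *)
Lemma monomials_of_stable : mono (U_(ord0) *+ a)%MM \in W ->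
  forall m, mdeg m = a -> mono m \in W.
Proof.
move=> W0 m; move: {2}(a - m ord0)%N (erefl (a - m ord0)%N) => k.
elim: k m => [|k IH] m km dm.
  suff -> : m = (U_(ord0) *+ a)%MM by [].
  have m0 : m ord0 = a.
    apply/eqP; by rewrite eqn_leq -{1}dm mnm_le_mdeg /= -subn_eq0 km.
  have : (\sum_(i < n) m (lift ord0 i) = 0)%N.
    by move: dm; rewrite mdegE big_ord_recl m0 => /eqP; rewrite -{2}[a]addn0 eqn_add2l => /eqP.
  move=> /eqP; rewrite sum_nat_eq0 => /forallP mi; apply/mnmP => i.
  rewrite mulmnE mnm1E; have [j ->|->] := unliftP ord0 i.
    exact/eqP/mi.
  by rewrite eqxx mul1n.
have [i mi i0] : exists2 i, m i != 0%N & i != ord0.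
  apply/exists_inP; rewrite -[X in is_true X]negbK negb_exists_in; apply/negP.
  move=> /forall_inP mi0; have : mdeg m = m ord0.
    rewrite mdegE big_ord_recl big1 ?addn0 // => j _; apply/eqP.
    by apply: contraTT (isT) => /mi0; rewrite negbK.
  by move=> dm0; move: km; rewrite -dm0 dm subnn.
pose m' := (m - U_(i) + U_(ord0))%MM.
have mE : m = (m - U_(i) + U_(i))%MM by rewrite submK // lep1mP.
have dm' : mdeg m' = a by rewrite -dm [in RHS]mE !mdegD !mdeg1.
have m'0 : m' ord0 = (m ord0).+1.
  by rewrite mnmDE mnmBE !mnm1E (negPf i0) subn0 eqxx addn1.
have /IH/(_ dm') m'W : (a - m' ord0 = k)%N by rewrite m'0 subnS km.
have := @W_stable i ord0 _ ((m' ord0)%:R *: mono m) m'W.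
rewrite linearZ /= !val_mono // /polarize mderivX -scalerAr -mpolyXD.
rewrite addmK addmC -mE => /(_ erefl) /(memvZ (m' ord0)%:R^-1).
by rewrite scalerA mulVf ?scale1r // pnatr_eq0 m'0.
Qed.

(** The highest weight vector involves only ['X_ord0], hence is a multiple of its [a]-th power, from
    which all monomials are reached. *)
Lemma polarize_irreducible : W != 0%VS -> W = fullv.
Proof.
move=> /polarize_kernel[w [wW w0 dw]].
have wE m : m \in msupp (val w) -> m = (U_(ord0) *+ a)%MM.
  move=> mw; have dm : mdeg m = a.
    exact: dhomog_mf (dhomog_is_dhomog w) _ mw.
  have mj j : j != ord0 -> m j = 0%N.
    move=> j0; apply/eqP/negPn/negP => mj0.
    have := mcoeff_mderiv j (val w) (m - U_(j)).
    rewrite dw // mcoeff0 submK ?lep1mP // => /esym/eqP.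
    by rewrite mulrn_eq0 /= => /eqP; apply/eqP; rewrite -mcoeff_msupp.
  apply/mnmP => j; rewrite mulmnE mnm1E.
  have [->|j0] := eqVneq j ord0; last by rewrite mj.
  rewrite mul1n -dm mdegE big_ord_recl big1 ?addn0 // => k _.
  by rewrite mj // eq_sym neq_lift.
have W0 : mono (U_(ord0) *+ a)%MM \in W.
  have d0 : mdeg (U_(ord0 : 'I_n.+1) *+ a)%MM = a by rewrite mdegMn mdeg1 mul1n.
  have lw : mlead (val w) \in msupp (val w) by rewrite mlead_supp.
  have -> : mono (U_(ord0) *+ a)%MM = ((val w)@_(mlead (val w)))^-1 *: w.
    apply: val_inj; rewrite linearZ /= val_mono //; apply/mpolyP => m.
    rewrite mcoeffX mcoeffZ (wE _ lw); have [<-|m0] := eqVneq.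
      by rewrite mulVf // -(wE _ lw) -mcoeff_msupp.
    suff /memN_msupp_eq0 -> : m \notin msupp (val w) by rewrite mulr0.
    by apply: contraNN m0 => /wE ->.
  exact: memvZ.
apply/eqP; rewrite eqEsubv subvf; apply/subvP => v _.
rewrite (expand v); apply: memv_suml => m /eqP dm.
exact/memvZ/monomials_of_stable.
Qed.

End Irreducible.

(** * Spaces spanned by multiples of forms *)

Section Products.
Variables (F : numFieldType) (n : nat).
Local Notation S := (dhomog n.+1 F).

Definition hproj t (p : {mpoly F[n.+1]}) : S t := DHomog (pihomogP mdeg t p).

Fact hproj_is_linear t : linear (hproj t).
Proof. by move=> c p q; apply: val_inj; rewrite /= linearP. Qed.

HB.instance Definition _ t :=
  GRing.isLinear.Build _ _ _ _ (hproj t) (hproj_is_linear t).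

Lemma hprojK t p : p \is t.-homog -> val (hproj t p) = p.
Proof. exact: pihomog_dE. Qed.

Lemma hproj_val t (p : S t) : hproj t (val p) = p.
Proof. by apply: val_inj; rewrite hprojK // dhomog_is_dhomog. Qed.

(** The projection makes multiplication by any polynomial a linear map between fixed spaces. It is
    the true product when [e <= t] and [h] is homogeneous of degree [e]. *)
Definition mulf t e h (g : S (t - e)) : S t := hproj t (val g * h).

Fact mulf_is_linear t e h : linear (@mulf t e h).
Proof. by move=> c p q; rewrite /mulf linearP mulrDl -scalerAl linearP. Qed.

HB.instance Definition _ t e h :=
  GRing.isLinear.Build _ _ _ _ (@mulf t e h) (@mulf_is_linear t e h).

Definition mulp t e h : 'Hom(S (t - e), S t) := linfun (@mulf t e h).

Lemma mulpE t e h g : mulp t e h g = hproj t (val g * h).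
Proof. by rewrite lfunE. Qed.

Lemma mulp_val t e h g : (e <= t)%N -> h \is e.-homog ->
  val (mulp t e h g) = val g * h.
Proof.
move=> et hh; rewrite mulpE hprojK //.
by have := dhomogM (dhomog_is_dhomog g) hh; rewrite subnK.
Qed.

(** Infinite sequences let all initial segments of a family share one type; [span_mul] reads only
    the first [m] entries. *)
Definition forms_of (e : nat -> nat) (h : nat -> {mpoly F[n.+1]}) :=
  forall i, h i \is (e i).-homog.

Definition span_mul t (e : nat -> nat) (h : nat -> {mpoly F[n.+1]}) m : {vspace S t} :=
  (\sum_(i < m) limg (mulp t (e i) (h i)))%VS.

Lemma span_mulS t e h m :
  span_mul t e h m.+1 = (span_mul t e h m + limg (mulp t (e m) (h m)))%VS.
Proof. exact: big_ord_recr. Qed.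

Lemma span_mul_le t e h m k : (m <= k)%N -> (span_mul t e h m <= span_mul t e h k)%VS.
Proof.
move=> /subnK <-; elim: (k - m)%N => // j IH.
by rewrite addSn span_mulS (subv_trans IH) ?addvSl.
Qed.

Lemma eq_span_mul t e e' h h' m :
  (forall i, (i < m)%N -> e i = e' i) -> (forall i, (i < m)%N -> h i = h' i) ->
  span_mul t e h m = span_mul t e' h' m.
Proof. by move=> ee hh; apply: eq_bigr => i _; rewrite ee ?hh. Qed.

Lemma span_mulP t e h m (p : S t) :
    (forall i, (i < m)%N -> (e i <= t)%N) -> forms_of e h ->
  p \in span_mul t e h m <->
  exists2 g, forms_of (fun i => t - e i)%N g & val p = \sum_(i < m) g i * h i.
Proof.
move=> et hh; split; last first.
  move=> [g gh pE]; have -> : p = \sum_(i < m) mulp t (e i) (h i) (hproj _ (g i)).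
    apply: val_inj; rewrite pE raddf_sum; apply: eq_bigr => i _ /=.
    by rewrite mulp_val ?et ?hprojK.
  by apply: memv_sumr => i _; rewrite memv_img ?memvf.
elim: m p et => [|m IH] p et.
  rewrite /span_mul big_ord0 memv0 => /eqP ->; exists (fun=> 0); last by rewrite big_ord0.
  by move=> i; exact: rpred0.
rewrite span_mulS => /memv_addP[p1 /IH[i im|]]; first exact/et/ltnW.
move=> g gh p1E [_ /memv_imgP[gm _ ->] ->].
exists (fun i => if i == m then val gm else g i).
  by move=> i; case: eqP => [->|//]; exact: dhomog_is_dhomog.
rewrite big_ord_recr /= eqxx p1E mulp_val ?et //; congr (_ + _).
by apply: eq_bigr => i _; rewrite ltn_eqF.
Qed.

Lemma span_mul_mem t e h m i (g : S (t - e i)) :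
  (i < m)%N -> mulp t (e i) (h i) g \in span_mul t e h m.
Proof.
move=> im; apply: (subvP (sumv_sup (Ordinal im) isT (subvv _))).
by rewrite memv_img ?memvf.
Qed.

(** A bound valid for all degrees up to [t], so that bases of spaces of different degrees share one
    index type; basis entries past the dimension read as zero. *)
Definition dim_bound t := (\sum_(a < t.+1) \dim (fullv : {vspace S a}))%N.

Lemma expand_vbasis t a (g : S a) : (a <= t)%N ->
  exists c : nat -> F, g = \sum_(k < dim_bound t) c k *: (vbasis {:S a})`_k.
Proof.
move=> at_; have le : (\dim {:S a} <= dim_bound t)%N.
  by rewrite /dim_bound (bigD1 (Ordinal (at_ : a < t.+1)%N)) //= leq_addr.
pose c k := if insub k is Some i then coord (vbasis {:S a}) i g else 0.
exists c; rewrite {1}(coord_vbasis (memvf g)).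
transitivity (\sum_(k < \dim {:S a}) c k *: (vbasis {:S a})`_k).
  by apply: eq_bigr => i _; rewrite /c valK.
rewrite (big_ord_widen _ (fun k => c k *: (vbasis {:S a})`_k) le) big_mkcond /=.
apply: eq_bigr => k _; case: ltnP => // ak.
by rewrite nth_default ?scaler0 // size_tuple.
Qed.

Definition mul_index m t : finType := ('I_m * 'I_(dim_bound t))%type.

Definition mul_gens t (e : nat -> nat) (h : nat -> {mpoly F[n.+1]}) m (q : mul_index m t) : S t :=
  mulp t (e q.1) (h q.1) (vbasis {:S (t - e q.1)})`_q.2.

Lemma span_mul_gens t e h m :
  span_mul t e h m =
  <<[seq mul_gens e h (enum_val k) | k : 'I_#|mul_index m t|]>>%VS.
Proof.
apply/eqP; rewrite eqEsubv; apply/andP; split; last first.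
  by apply/span_subvP => _ /mapP[k _ ->]; exact: span_mul_mem.
apply/subv_sumP => i _; apply/subvP => _ /memv_imgP[g _ ->].
have [c ->] := expand_vbasis g (leq_subr (e i) t).
rewrite linear_sum; apply: memv_suml => k _; rewrite linearZ /=; apply/memvZ.
apply: memv_span; apply/mapP; exists (enum_rank ((i, k) : mul_index m t)).
  by rewrite mem_enum.
by rewrite enum_rankK.
Qed.

(** The generators [mul_gens] depend linearly on the forms, so moving [h] along [b] moves them along
    the generators of [b]; [max_rank_tangent] applies with the coordinates of the [g i] as the
    relation. *)
Lemma syzygy_tangent t e h m g b :
    (forall i, (i < m)%N -> (e i <= t)%N) -> forms_of e h -> forms_of e b ->
    forms_of (fun i => t - e i)%N g ->
    (forall h', forms_of e h' -> (\dim (span_mul t e h' m) <= \dim (span_mul t e h m))%N) ->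
    \sum_(i < m) g i * h i = 0 ->
  hproj t (\sum_(i < m) g i * b i) \in span_mul t e h m.
Proof.
move=> et hh hb hg hmax gh0.
have /choice[c cE] : forall i : 'I_m, exists c : nat -> F,
    hproj (t - e i) (g i) = \sum_(k < dim_bound t) c k *: (vbasis {:S (t - e i)})`_k.
  by move=> i; apply/expand_vbasis/leq_subr.
pose u (q : mul_index m t) := c q.1 q.2.
have sumE h' : forms_of e h' ->
    \sum_(k : 'I_#|mul_index m t|) u (enum_val k) *: mul_gens e h' (enum_val k) =
    hproj t (\sum_(i < m) g i * h' i).
  move=> hh'; transitivity (\sum_(q : mul_index m t) u q *: mul_gens e h' q).
    by rewrite [RHS](reindex _ (onW_bij _ (enum_val_bij (mul_index m t)))).
  transitivity (\sum_(i < m) \sum_(k < dim_bound t) u (i, k) *: mul_gens e h' (i, k)).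
    by rewrite pair_big; apply: eq_big => [[]|[]].
  rewrite linear_sum /=.
  apply: eq_bigr => i _; rewrite -(hprojK (hg i)) -mulpE cE linear_sum.
  by apply: eq_bigr => k _; rewrite linearZ.
rewrite -sumE // span_mul_gens; apply: max_rank_tangent; last first.
  by rewrite sumE // gh0 linear0.
move=> x; rewrite -span_mul_gens.
pose h' i := h i + x *: b i.
have hh' : forms_of e h' by move=> i; rewrite rpredD ?rpredZ.
apply: leq_trans (hmax h' hh'); rewrite span_mul_gens.
apply: eq_leq; congr (\dim <<_>>); apply: eq_map => k.
by rewrite /mul_gens !mulpE /h' mulrDr -scalerAr linearD linearZ.
Qed.

End Products.

(** * Relations among forms of maximal rank *)

Section GenericRank.
Variables (F : numFieldType) (n t : nat) (e : nat -> nat).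
Variable h : nat -> {mpoly F[n.+1]}.
Local Notation S := (dhomog n.+1 F).
Local Notation V := (span_mul t e h).
Hypothesis hh : forms_of e h.

Definition max_rank m := forall h' : nat -> {mpoly F[n.+1]},
  forms_of e h' -> (\dim (span_mul t e h' m) <= \dim (V m))%N.

(* [kernel m] and [colon d m] are the spaces of the [c] and [J] of the
   introduction, for the first [m] forms. *)
Definition kernel m : {vspace S (t - e m)} := (mulp t (e m) (h m) @^-1: V m)%VS.

Lemma mem_kernel m c : (c \in kernel m) = (hproj t (val c * h m) \in V m).
Proof. by rewrite -memv_preim mulpE. Qed.

(** The multiples of [h m] contribute [S (t - e m)] modulo [kernel m]: rank-nullity combined with
    the dimension of a sum. *)
Lemma dim_span_mulS m :
  (\dim (V m.+1) + \dim (kernel m) = \dim (V m) + \dim {:S (t - e m)})%N.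
Proof.
rewrite span_mulS; set f := mulp _ _ _.
have dk : \dim (kernel m) = (\dim (lker f) + \dim (V m :&: limg f))%N.
  rewrite /kernel -lpreim_cap_limg -/f -(limg_ker_dim f (f @^-1: _)).
  rewrite lpreimK ?capvSr //; congr (\dim _ + _)%N.
  by apply/capv_idPr; rewrite -lpreim0 lpreimS ?sub0v.
have := dimv_sum_cap (V m) (limg f); have := limg_ker_dim f fullv.
by rewrite dk capfv => <- E; rewrite addnCA E addnCA.
Qed.

Definition colon d m : {vspace S (t - d)} :=
  (\bigcap_(i < \dim {:S d}) (mulp t d (val (vbasis {:S d})`_i) @^-1: V m))%VS.

Lemma mem_colon d m g :
  g \in colon d m <-> forall s, s \is d.-homog -> hproj t (val g * s) \in V m.
Proof.
rewrite memvE; split=> [/subv_bigcapP gJ s hs|gV].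
  rewrite -(hprojK hs) (coord_vbasis (memvf (hproj d s))).
  rewrite [X in _ * X](linear_sum (@mpoly_of_dhomog _ _ d)) mulr_sumr.
  rewrite linear_sum; apply: memv_suml => i _; rewrite linearZ /= -scalerAr.
  rewrite linearZ; apply/memvZ; move: (gJ i isT).
  by rewrite -memvE -memv_preim mulpE.
apply/subv_bigcapP => i _; rewrite -memvE -memv_preim mulpE.
exact/gV/dhomog_is_dhomog.
Qed.

Lemma colon_le d m : (colon d m <= colon d m.+1)%VS.
Proof.
apply/subvP => g /mem_colon gV; apply/mem_colon => s /gV.
exact/subvP/span_mul_le.
Qed.

(** Products of forms of degrees [t - d] and [d] span all forms of degree [t]. *)
Lemma colon_full d m : (d <= t)%N -> colon d m = fullv -> V m = fullv.
Proof.
move=> dt cf; apply/eqP; rewrite eqEsubv subvf; apply/subvP => p _.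
rewrite -(hproj_val p); have : val p \is (t - d + d).-homog.
  by rewrite subnK // dhomog_is_dhomog.
move: (val p); apply: dhomogD_ind => [|c u v uV vV|u v hu hv].
- by rewrite linear0 mem0v.
- by rewrite linearP memvD ?memvZ.
- have /mem_colon/(_ v hv) : hproj (t - d) u \in colon d m by rewrite cf memvf.
  by rewrite hprojK.
Qed.

Section Step.
Variable m : nat.
Hypothesis et : forall i, (i <= m)%N -> (e i <= t)%N.
Hypothesis hmax : max_rank m.+1.

(** An element of the kernel is a relation among the first [m.+1] forms, with coefficient [- c] at
    [h m]; the tangent argument then applies to every coefficient separately. *)
Lemma kernel_syzygy c : c \in kernel m ->
  exists g, [/\ forms_of (fun i => t - e i)%N g,
    val c * h m = \sum_(i < m) g i * h i,
    forall b, b \is (e m).-homog -> hproj t (val c * b) \in V m.+1 &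
    forall i b, (i < m)%N -> b \is (e i).-homog -> hproj t (g i * b) \in V m.+1].
Proof.
have etm : forall i, (i < m)%N -> (e i <= t)%N by move=> i /ltnW/et.
rewrite mem_kernel => /(span_mulP _ etm hh)[g hg].
rewrite -mulpE mulp_val ?et // => cE.
pose g' i := if i == m then - val c else g i.
have hg' : forms_of (fun i => t - e i)%N g'.
  move=> i; rewrite /g'; case: eqP => [->|//].
  by rewrite rpredN dhomog_is_dhomog.
have gh0 : \sum_(i < m.+1) g' i * h i = 0.
  rewrite big_ord_recr /= /g' eqxx mulNr cE; apply/eqP; rewrite subr_eq0; apply/eqP.
  by apply: eq_bigr => i _; rewrite ltn_eqF.
(* Only the form of index [i] is moved, in the direction [b]. *)
have gV i b : (i <= m)%N -> b \is (e i).-homog -> hproj t (g' i * b) \in V m.+1.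
  move=> im hb; pose b' j := if j == i then b else 0.
  have hb' : forms_of e b'.
    by move=> j; rewrite /b'; case: eqP => [->//|_]; exact: rpred0.
  have := @syzygy_tangent F n t e h m.+1 _ _ et hh hb' hg' hmax gh0.
  rewrite (bigD1 (Ordinal (im : i < m.+1)%N)) //= /b' eqxx big1 ?addr0 // => j ji.
  by rewrite (negPf (ji : val j != i)) mulr0.
exists g; split=> // [b hb|i b im hb].
  by have := gV m b (leqnn m) hb; rewrite /g' eqxx mulNr linearN memvN.
by have := gV i b (ltnW im) hb; rewrite /g' ltn_eqF.
Qed.

(** Every [c] of degree [t - e m] then multiplies all forms of degree [e m] into [V m.+1]. *)
Lemma kernel_full : kernel m = fullv -> V m.+1 = fullv.
Proof.
move=> kf; apply: (@colon_full (e m)); first exact: et.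
apply/eqP; rewrite eqEsubv subvf; apply/subvP => c _; apply/mem_colon.
by have /kernel_syzygy[g []] : c \in kernel m by rewrite kf memvf.
Qed.

(* Apply [x_i d/dx_j] to a relation [c * h m = \sum_l g l * h l]: since the
   [g l] and [c] multiply all forms into [V m], only [x_i dc/dx_j * h m] and
   multiples of the [h l], [l < m], survive modulo [V m]. *)
Lemma kernel_irreducible d : (forall i, (i <= m)%N -> (d <= e i)%N) ->
  colon d m.+1 = colon d m -> kernel m != 0%VS -> V m.+1 = fullv.
Proof.
move=> de cE k0; apply/kernel_full/polarize_irreducible => // i j c v ck vE.
have [g [hg cgE cV gV]] := kernel_syzygy ck.
(* Membership descends from [V m.+1] to [V m]: writing [b] through products [p * q] with [q] of
   degree [d], each [a * p] lies in [colon d m.+1], which equals [colon d m]. *)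
have down a l b : (l <= m)%N -> a \is (t - e l).-homog -> b \is (e l).-homog ->
    (forall b', b' \is (e l).-homog -> hproj t (a * b') \in V m.+1) ->
    hproj t (a * b) \in V m.
  move=> lm ha + aV; rewrite -{1}(subnK (de l lm)); move: b.
  apply: dhomogD_ind => [|x u w uV wV|p q hp hq].
  - by rewrite mulr0 linear0 mem0v.
  - by rewrite mulrDr -scalerAr linearP memvD ?memvZ.
  have hap : a * p \is (t - d).-homog.
    have := dhomogM ha hp; rewrite addnBA ?de // subnK ?et //.
  have : hproj (t - d) (a * p) \in colon d m.
    rewrite -cE; apply/mem_colon => s hs; rewrite hprojK // -mulrA; apply: aV.
    by have := dhomogM hp hs; rewrite subnK ?de.
  by move=> /mem_colon/(_ q hq); rewrite hprojK // mulrA.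
rewrite mem_kernel vE.
have /(congr1 (polarize i j)) := cgE.
rewrite polarizeM linear_sum => /(canRL (addrK _)) ->.
rewrite linearB linear_sum /=; apply: memvB; last first.
  apply: (@down _ m) => //; first exact: (dhomog_is_dhomog c).
  exact/polarize_homog/hh.
apply: memv_suml => l _; rewrite polarizeM linearD; apply: memvD.
  have := span_mul_mem h (hproj (t - e l) (polarize i j (g l))) (ltn_ord l).
  by rewrite mulpE hprojK //; exact/polarize_homog/hg.
apply: (@down _ l); first exact: ltnW.
- exact: hg.
- exact/polarize_homog/hh.
- by move=> b; apply: gV.
Qed.

Lemma kernel_grow d : (forall i, (i <= m)%N -> (d <= e i)%N) ->
  kernel m != 0%VS -> V m.+1 = fullv \/ (\dim (colon d m) < \dim (colon d m.+1))%N.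
Proof.
move=> de k0; have [cE|cN] := eqVneq (colon d m) (colon d m.+1).
  by left; exact: (@kernel_irreducible d).
right; rewrite ltn_neqAle (dimvS (colon_le d m)) andbT.
by rewrite (dimv_leqif_eq (colon_le d m)).
Qed.

(** A kernel element [c] multiplies every form of degree [e m] into [V m.+1], in particular the next
    form [h m.+1]. *)
Lemma kernel_persist : e m.+1 = e m -> kernel m != 0%VS -> kernel m.+1 != 0%VS.
Proof.
rewrite -!vpick0 => eS; set c := vpick _ => c0.
have [g [_ _ cV _]] := kernel_syzygy (memv_pick (kernel m)).
pose c' : S (t - e m.+1) := hproj _ (val c).
have c'E : val c' = val c by rewrite hprojK // eS dhomog_is_dhomog.
rewrite vpick0; apply: contraNneq c0 => k0; rewrite -(inj_eq val_inj) -c'E.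
suff : c' \in kernel m.+1 by rewrite k0 memv0 => /eqP ->.
by rewrite mem_kernel c'E; apply: cV; rewrite -eS.
Qed.

End Step.

(** The kernel stays nonzero along the run, so each step raises the dimension of [V] by at most
    [\dim {:S (t - e m)} - 1], and raises that of the colon space unless [V] is full. After [N]
    raises the colon space is everything, and [colon_full] applies. *)
Lemma run_full d m (N := \dim {:S (t - d)}) :
    (d <= t)%N -> (forall i, (i < m + N)%N -> d <= e i <= t)%N ->
    (forall j, (j < N)%N -> e (m + j)%N = e m) ->
    (forall j, (j < N)%N -> max_rank (m + j).+1) ->
    kernel m != 0%VS ->
  V (m + N)%N = fullv /\
  (\dim (V (m + N)) <= \dim (V m) + N * (\dim {:S (t - e m)} - 1))%N.
Proof.
move=> dt ede ec hm k0.
have et k i : (k < N)%N -> (i <= m + k)%N -> (e i <= t)%N.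
  move=> kN ik; suff /ede/andP[] : (i < m + N)%N by [].
  by rewrite (leq_ltn_trans ik) // ltn_add2l.
have de k i : (k < N)%N -> (i <= m + k)%N -> (d <= e i)%N.
  move=> kN ik; suff /ede/andP[] : (i < m + N)%N by [].
  by rewrite (leq_ltn_trans ik) // ltn_add2l.
have kj j : (j < N)%N -> kernel (m + j) != 0%VS.
  elim: j => [|j IH] jN; first by rewrite addn0.
  rewrite addnS; apply: kernel_persist => //.
    - by move=> i; apply/et/ltnW.
    - exact/hm/ltnW.
    - by rewrite -addnS (ec _ jN) (ec _ (ltnW jN)).
    - exact/IH/ltnW.
have main j : (j <= N)%N ->
    (V (m + j)%N = fullv \/ (j <= \dim (colon d (m + j)))%N) /\
    (\dim (V (m + j)) <= \dim (V m) + j * (\dim {:S (t - e m)} - 1))%N.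
  elim: j => [|j IH] jN; first by rewrite addn0 leq_addr; split; [right|].
  have [IH1 IH2] := IH (ltnW jN); split; rewrite addnS.
    case: IH1 => [Vf|dj].
      left; apply/eqP; rewrite eqEsubv subvf -Vf; exact: span_mul_le.
    have [Vf|grow] :=
      kernel_grow (fun i => et j i jN) (hm j jN) (fun i => de j i jN) (kj j jN).
      by left.
    by right; apply: leq_ltn_trans dj _.
  have eM : \dim {:S (t - e (m + j))} = \dim {:S (t - e m)} by rewrite ec.
  have := dim_span_mulS (m + j); rewrite eM.
  have := kj j jN; rewrite -dimv_eq0 -lt0n mulSn.
  move: (\dim (kernel _)) (\dim (V _.+1)) IH2 => a b; lia.
have [[Vf|dN] dV] := main N (leqnn N); split=> //.
apply: (@colon_full d) => //.
by apply/eqP; rewrite eqEdim subvf.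
Qed.

End GenericRank.

(** * General forms *)

Lemma max_rank_exists (F : numFieldType) n t e m :
  exists2 h : nat -> {mpoly F[n.+1]}, forms_of e h & max_rank t e h m.
Proof.
pose P r := `[< exists2 h : nat -> {mpoly F[n.+1]}, forms_of e h &
  \dim (span_mul t e h m) = r >].
have exP : exists r, P r.
  exists (\dim (span_mul t e (fun=> 0 : {mpoly F[n.+1]}) m)).
  by apply/asboolP; exists (fun=> 0) => // i; exact: rpred0.
have ubP r : P r -> (r <= \dim {:dhomog n.+1 F t})%N.
  by move=> /asboolP[h _ <-]; apply/dimvS/subvf.
have [r /asboolP[h hh <-] hmax] := ex_maxnP exP ubP.
by exists h => // h' hh'; apply: hmax; apply/asboolP; exists h'.
Qed.

Section OpenRank.
Variables (F : numFieldType) (n : nat) (J : finType) (e : J -> nat).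
Variable js : seq J.
Hypothesis js_uniq : uniq js.
Implicit Types (f : forms F n.+1 e).

Definition form_seq f i : {mpoly F[n.+1]} := nth 0 [seq val (f j) | j <- js] i.

Local Notation es := (nth 0%N [seq e j | j <- js]).

Lemma form_seq_homog f : forms_of es (form_seq f).
Proof.
move=> i; rewrite /form_seq; case: (ltnP i (size js)) => ij; last first.
  by rewrite nth_default ?size_map // rpred0.
have j0 : J by case: js ij.
by rewrite !(nth_map j0) //; exact: dhomog_is_dhomog.
Qed.

Lemma form_seq_onto h : forms_of es h ->
  exists f, forall i, (i < size js)%N -> form_seq f i = h i.
Proof.
move=> hh; exists (fun j => hproj (e j) (h (index j js))) => i ij.
have j0 : J by case: js ij.
rewrite /form_seq (nth_map j0) // index_uniq // hprojK //.
by have := hh i; rewrite (nth_map j0).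
Qed.

Let unit_form (c : 'I_#|{: @coef_index n.+1 J e}%type|) j : {mpoly F[n.+1]} :=
  let s := enum_val c in if tag s == j then 'X_[val (val (tagged s))] else 0.

(** Linearity in the coefficients is what brings [mul_gens] into the shape required by
    [rank_open]. *)
Lemma form_coefs f j : val (f j) = \sum_c coefs f c *: unit_form c j.
Proof.
pose G (s : @coef_index n.+1 J e) : {mpoly F[n.+1]} :=
  (val (f (tag s)))@_(val (val (tagged s))) *:
    if tag s == j then 'X_[val (val (tagged s))] else 0.
transitivity (\sum_(s : @coef_index n.+1 J e) G s); last first.
  by rewrite [LHS](reindex _ (onW_bij _ (enum_val_bij (@coef_index n.+1 J e)))).
pose H i (x : {m : 'X_{1..n.+1 < (e i).+1} | mdeg m == e i}) := G (Tagged _ x).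
transitivity (\sum_i \sum_x H i x); last by rewrite sig_big_dep; apply: eq_big => -[].
rewrite (bigD1 j) //= [X in _ + X]big1 ?addr0 => [|i ij]; last first.
  by rewrite big1 // => x _; rewrite /H /G /= (negPf ij) scaler0.
rewrite -[LHS](pihomog_dE (dhomog_is_dhomog (f j))) (@pihomogwE _ _ _ _ (e j).+1).
  rewrite (reindex_omap
    (val : {m : 'X_{1..n.+1 < (e j).+1} | mdeg m == e j} -> _) insub) => [|m mj].
    apply: eq_big => [x|x _]; first by rewrite valK eqxx andbT (valP x).
    by rewrite /H /G /= eqxx.
  by rewrite insubT.
rewrite mmeasureE; apply/bigmax_leqP_seq => m mf _; rewrite ltnS.
by rewrite (dhomog_mf (dhomog_is_dhomog (f j)) mf).
Qed.

(** [rank_open] at a point [f0] attaining the maximal dimension: where [P] does not vanish, the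
    dimension is at least as large. *)
Lemma max_rank_open1 t m : (m <= size js)%N ->
  exists P f0, P.@[coefs f0] != 0 /\
    forall f, P.@[coefs f] != 0 -> max_rank t es (form_seq f) m.
Proof.
move=> mj; have [h hh hmax] := max_rank_exists F n t es m.
have [f0 f0E] := form_seq_onto hh.
pose x c (k : 'I_#|mul_index F n m t|) := mul_gens es
  (fun i => nth 0 [seq unit_form c j | j <- js] i) (enum_val k).
have [P Pf0 PP] := rank_open x (coefs f0).
have VE f : (span_mul t es (form_seq f) m =
    <<[seq (\sum_c coefs f c *: x c k)%R | k : 'I_#|mul_index F n m t|]>>)%VS.
  rewrite span_mul_gens; congr <<_>>%VS; apply: eq_map => k.
  rewrite /x /mul_gens mulpE; set i := (enum_val k).1.
  have ij : (i < size js)%N by apply: leq_trans mj.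
  have j0 : J by case: js ij.
  rewrite /form_seq (nth_map j0 0 (fun j => val (f j))) // form_coefs.
  rewrite mulr_sumr linear_sum; apply: eq_bigr => c _.
  by rewrite -scalerAr linearZ /= mulpE (nth_map j0 0 (unit_form c)).
exists P, f0; split=> // f /PP; rewrite -!VE => le h' hh'.
apply: leq_trans le; have -> : span_mul t es (form_seq f0) m = span_mul t es h m.
  by apply: eq_span_mul => // i im; rewrite f0E // (leq_trans im).
exact: hmax.
Qed.

Lemma max_rank_open (s : seq (nat * nat)) : all (fun q => q.2 <= size js)%N s ->
  exists P f0, P.@[coefs f0] != 0 /\
    forall f, P.@[coefs f] != 0 ->
      {in s, forall q, max_rank q.1 es (form_seq f) q.2}.
Proof.
elim: s => [_|[t m] s IH /= /andP[mj /IH[Q [g [Qg Qmax]]]]].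
  exists 1, (fun=> 0); split=> [|f _ q //]; by rewrite meval1 oner_neq0.
have [P [f [Pf Pmax]]] := max_rank_open1 t mj.
have [c PQc] := meval_common_nonroot Pf Qg.
exists (P * Q), (fun j => f j + c *: (g j - f j)); split.
  suff /meval_eq -> : coefs (fun j => f j + c *: (g j - f j)) =1
      (fun i => coefs f i + c * (coefs g i - coefs f i)) by [].
  move=> i; rewrite /coefs.
  by rewrite mcoeffD mcoeffZ mcoeffB.
move=> f'; rewrite mevalM mulf_eq0 => /norP[Pf' Qf'] q.
by rewrite inE => /predU1P[->|/Qmax]; [exact: Pmax | exact].
Qed.

End OpenRank.

(** * The dimension attained by general forms of given degrees *)

Section GenericRankOfType.
Variables (F : numFieldType) (n : nat).
Local Notation S := (dhomog n.+1 F).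
Local Notation N := (Ndim n.+1).
Implicit Types (es : seq nat).

(* The dimension of the degree [t] part of the ideal of general forms of
   degrees [es]. *)
Definition rho t es : nat :=
  let h := s2val (cid2 (max_rank_exists F n t (nth 0%N es) (size es))) in
  \dim (@span_mul F n t (nth 0%N es) h (size es)).

(** Both sides are maxima over the same choices of [m] forms; filling up with zeros turns forms for
    either degree list into forms for the other. *)
Lemma rhoE t es (h : nat -> {mpoly F[n.+1]}) m : forms_of (nth 0%N es) h -> (m <= size es)%N ->
  max_rank t (nth 0%N es) h m ->
  \dim (span_mul t (nth 0%N es) h m) = rho t (take m es).
Proof.
move=> hh mes hmax; rewrite /rho; case: cid2 => h' /= hh' hmax'.
rewrite size_takel // in hmax' *; apply/eqP; rewrite eqn_leq; apply/andP; split.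
  pose h0 i := if (i < m)%N then h i else 0.
  have hh0 : forms_of (nth 0%N (take m es)) h0.
    by move=> i; rewrite /h0; case: ltnP => im; rewrite ?rpred0 ?nth_take.
  apply: leq_trans (hmax' h0 hh0); apply/eq_leq; congr (\dim _).
  by apply: eq_span_mul => i im; rewrite ?nth_take // /h0 im.
pose h0 i := if (i < m)%N then h' i else 0.
have hh0 : forms_of (nth 0%N es) h0.
  move=> i; rewrite /h0; case: ltnP => im; rewrite ?rpred0 //.
  by have := hh' i; rewrite nth_take.
apply: leq_trans (hmax h0 hh0); apply/eq_leq; congr (\dim _).
by apply: eq_span_mul => i im; rewrite ?nth_take // /h0 im.
Qed.

Lemma generic_exists t es : exists2 h : nat -> {mpoly F[n.+1]},
  forms_of (nth 0%N es) h &
  forall m, (m <= size es)%N -> max_rank t (nth 0%N es) h m.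
Proof.
pose e (i : 'I_(size es)) := nth 0%N es i.
have esE : [seq e j | j <- enum 'I_(size es)] = es.
  apply: (@eq_from_nth _ 0%N) => [|i]; rewrite size_map size_enum_ord // => im.
  by rewrite (nth_map (Ordinal im)) ?size_enum_ord // /e nth_enum_ord.
pose s := [seq (t, m) | m <- iota 0 (size es).+1].
have [||P [f [Pf hmax]]] := @max_rank_open F n _ e (enum 'I_(size es)) _ s.
- exact: enum_uniq.
- by rewrite size_enum_ord; apply/allP => _ /mapP[m + ->] /=; rewrite mem_iota.
exists (form_seq (enum 'I_(size es)) f); first by rewrite -{1}esE; exact: form_seq_homog.
move=> m mes; rewrite -{1}esE; apply: (hmax _ Pf (t, m)).
by apply: map_f; rewrite mem_iota.
Qed.

Lemma dim_hom t : \dim {:S t} = N t.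
Proof. exact: dim_forms. Qed.

Lemma rho_generic t es : exists2 h : nat -> {mpoly F[n.+1]},
  forms_of (nth 0%N es) h &
  forall m, (m <= size es)%N ->
    max_rank t (nth 0%N es) h m /\
    \dim (span_mul t (nth 0%N es) h m) = rho t (take m es).
Proof.
have [h hh hmax] := generic_exists t es; exists h => // m mes.
by split; [exact: hmax | apply: rhoE => //; exact: hmax].
Qed.

Lemma rho_nil t : rho t [::] = 0%N.
Proof. by rewrite /rho /span_mul big_ord0 dimv0. Qed.

Lemma rho_le t es : (rho t es <= N t)%N.
Proof. by rewrite -dim_hom; apply/dimvS/subvf. Qed.

Lemma rho_cat t es s : (rho t es <= rho t (es ++ s))%N.
Proof.
have [h hh hE] := rho_generic t (es ++ s).
have [|_] := hE (size es); first by rewrite size_cat leq_addr.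
have [//|_] := hE (size (es ++ s)); rewrite take_size take_size_cat // => <- <-.
by apply/dimvS/span_mul_le; rewrite size_cat leq_addr.
Qed.

(** If the new form adds nothing, the kernel is the whole space and [kernel_full] applies. *)
Lemma rho_rcons t es a (M := N (t - a)) : all (fun e => e <= t)%N (rcons es a) ->
  (rho t (rcons es a) <= rho t es + M)%N /\
  (rho t (rcons es a) = rho t es -> rho t es = N t).
Proof.
move=> /allP est; have [h hh hE] := rho_generic t (rcons es a).
have tk : take (size es) (rcons es a) = es by rewrite -cats1 take_size_cat.
have [|_] := hE (size es); first by rewrite size_rcons.
have [//|] := hE (size (rcons es a)); rewrite take_size size_rcons tk.
move=> hmax <- <-; have := dim_span_mulS t (nth 0%N (rcons es a)) h (size es).
have aE : nth 0%N (rcons es a) (size es) = a by rewrite nth_rcons ltnn eqxx.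
have ME : \dim {:S (t - nth 0%N (rcons es a) (size es))} = M by rewrite dim_hom aE.
rewrite ME => dE; split=> [|E]; first by rewrite -dE leq_addr.
have et i : (i <= size es)%N -> (nth 0%N (rcons es a) i <= t)%N.
  by move=> ies; rewrite est // mem_nth // size_rcons.
rewrite -E (kernel_full hh et hmax) ?dim_hom //.
apply/eqP; rewrite eqEdim subvf ME.
by move/eqP: dE; rewrite E eqn_add2l => /eqP ->; rewrite leqnn.
Qed.

(** Growth by less than [M] means a nonzero kernel, which starts the run of [run_full]. *)
Lemma rho_run t d es a (M := N (t - a)) (K := N (t - d)) :
    all (fun e => d <= e <= t)%N es -> (d <= a <= t)%N ->
    (rho t (rcons es a) < rho t es + M)%N ->
  rho t (es ++ nseq K a) = N t /\ (N t <= rho t es + K * (M - 1))%N.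
Proof.
move=> /allP est /andP[da at_] lt_rho; pose es' := es ++ nseq K a.
have [h hh hE] := rho_generic t es'; pose m := size es.
have K0 : (0 < K)%N by rewrite /K /Ndim bin_gt0; lia.
have size_es' : size es' = (m + K)%N by rewrite size_cat size_nseq.
have eE j : (j < K)%N -> nth 0%N es' (m + j) = a.
  by move=> jK; rewrite nth_cat ltnNge leq_addr /= addKn nth_nseq jK.
have tk j : (j <= K)%N -> take (m + j) es' = es ++ nseq j a.
  move=> jK; rewrite take_cat ltnNge leq_addr /= addKn; congr (_ ++ _).
  by rewrite take_nseq.
have dV j : (j <= K)%N -> \dim (span_mul t (nth 0%N es') h (m + j)) = rho t (es ++ nseq j a).
  by move=> jK; have [|_ ->] := hE (m + j)%N; rewrite ?size_es' ?leq_add2l // tk.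
have M_E : \dim {:S (t - nth 0%N es' m)} = M by rewrite dim_hom -(addn0 m) eE.
have V0 : \dim (span_mul t (nth 0%N es') h m) = rho t es.
  by have := dV 0%N isT; rewrite addn0 cats0.
have V1 : \dim (span_mul t (nth 0%N es') h m.+1) = rho t (rcons es a).
  by have := dV 1%N K0; rewrite addn1 cats1.
have := dim_span_mulS t (nth 0%N es') h m; rewrite M_E V0 V1 => dE.
have k0 : kernel t (nth 0%N es') h m != 0%VS.
  by rewrite -dimv_eq0; apply/negP => /eqP k0; move: lt_rho; rewrite -dE k0 addn0 ltnn.
have KE : K = \dim {:S (t - d)} by rewrite dim_hom.
have := @run_full F n t (nth 0%N es') h hh d m; rewrite -KE.
case=> [||||//|Vf Vle].
- exact: leq_trans da at_.
- move=> i im; have : nth 0%N es' i \in es' by rewrite mem_nth ?size_es'.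
  by rewrite mem_cat => /orP[/est //|/nseqP[-> _]]; rewrite da.
- by move=> j jK; rewrite eE // -(eE 0%N K0) addn0.
- by move=> j jK; have [|] := hE (m + j).+1; rewrite ?size_es' -?addnS ?leq_add2l.
have := dV K (leqnn K); rewrite Vf dim_hom => <-; split=> //.
by move: Vle; rewrite Vf dim_hom M_E V0.
Qed.

End GenericRankOfType.

(** * Counting *)

Local Close Scope ring_scope.
Local Open Scope nat_scope.

Lemma Ndim_bin n t : Ndim n.+1 t = 'C(n + t, n).
Proof. by rewrite /Ndim addSn subn1 /= -bin_sub ?leq_addl // addnK. Qed.

Lemma Ndim_gt0 n t : 0 < Ndim n.+1 t.
Proof. by rewrite Ndim_bin bin_gt0 leq_addr. Qed.

Lemma Ndim_le n s t : s <= t -> Ndim n.+1 s <= Ndim n.+1 t.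
Proof. by move=> st; rewrite !Ndim_bin leq_bin2l // leq_add2l. Qed.

Lemma Ndim_lt n s t : 0 < n -> s < t -> Ndim n.+1 s < Ndim n.+1 t.
Proof.
case: n => // n _ st; apply: leq_trans (Ndim_le n.+1 st).
by rewrite !Ndim_bin addnS binS addSn -ltn_subLR ?leqnn // subnn bin_gt0 leqW // leq_addr.
Qed.

(** In the induction on [n], the step compares [n.+1 * (n.+1 + (s + t))] with
    [(n.+1 + s) * (n.+1 + t)], which exceeds it by [s * t]. *)
Lemma Ndim_add n s t : Ndim n.+1 (s + t) <= Ndim n.+1 s * Ndim n.+1 t.
Proof.
rewrite !Ndim_bin; elim: n => [|n IH]; first by rewrite !bin0.
have E u : n.+1 * 'C(n.+1 + u, n.+1) = (n.+1 + u) * 'C(n + u, n).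
  by rewrite addSn mul_bin_diag.
rewrite -(@leq_pmul2l (n.+1 * n.+1)) //.
have -> : n.+1 * n.+1 * ('C(n.+1 + s, n.+1) * 'C(n.+1 + t, n.+1)) =
          (n.+1 + s) * (n.+1 + t) * ('C(n + s, n) * 'C(n + t, n)).
  by rewrite mulnACA !E mulnACA.
rewrite -mulnA E mulnA; apply: leq_mul => //; nia.
Qed.

(** * Bounds for the generic dimension *)

Section Expected.
Variables (F : numFieldType) (n t d : nat).
Local Notation N := (Ndim n.+1).
Local Notation rho := (@rho F n t).
Local Notation K := (N (t - d)).

Let in_range e := d <= e <= t.

Lemma in_range_le s : all in_range s -> all (fun e => e <= t) s.
Proof. by apply: sub_all => e /andP[]. Qed.

Lemma cat_nseqS (es : seq nat) c a : es ++ nseq c.+1 a = rcons (es ++ nseq c a) a.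
Proof. by rewrite -addn1 nseqD catA cats1. Qed.

(** Forms before the first deficient one lose nothing. From there on fewer than [K] forms remain,
    since the space is not full, and each still adds at least one dimension, so loses at most
    [M - 1 <= K - 1]. *)
Lemma rho_nseq es a c : all in_range es -> in_range a ->
  rho (es ++ nseq c a) < N t ->
  rho es + c * N (t - a) <= rho (es ++ nseq c a) + K * (K - 1).
Proof.
set M := N (t - a) => es_r a_r.
have all_r x : all in_range (es ++ nseq x a).
  by rewrite all_cat es_r all_nseq a_r orbT.
have all_t x : all (fun e => e <= t) (es ++ nseq x a) by exact/in_range_le/all_r.
have MK : M <= K by apply: Ndim_le; case/andP: a_r; lia.
have M0 : 0 < M by exact: Ndim_gt0.
have mono x y : x <= y -> rho (es ++ nseq x a) <= rho (es ++ nseq y a).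
  by move=> /subnKC <-; rewrite nseqD catA rho_cat.
have step x : rho (es ++ nseq x.+1 a) <= rho (es ++ nseq x a) + M.
  by rewrite cat_nseqS; have [] := @rho_rcons F n t (es ++ nseq x a) a; rewrite -?cat_nseqS.
have grow x : rho (es ++ nseq x a) < N t -> rho (es ++ nseq x a) < rho (es ++ nseq x.+1 a).
  move=> lt; rewrite ltn_neqAle mono // andbT; apply: contraTneq lt => E.
  have [|_ ->] := @rho_rcons F n t (es ++ nseq x a) a; rewrite -?cat_nseqS //.
  by rewrite ltnn.
move=> not_full.
(* [m] counts the forms of degree [a] added before the first deficient one. *)
have first_def x : rho (es ++ nseq x a) = rho es + x * M \/
    exists m, [/\ m < x, rho (es ++ nseq m a) = rho es + m * M &
                 rho (es ++ nseq m.+1 a) < rho (es ++ nseq m a) + M].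
  elim: x => [|x [IH|[m [mx mE mS]]]]; first by left; rewrite cats0 addn0.
    have := step x; rewrite leq_eqVlt => /orP[/eqP xE|lt]; last by right; exists x.
    by left; rewrite xE IH mulSn -addnA [M + _]addnC.
  by right; exists m; rewrite ltnS ltnW.
have [->|[m [mc mE mS]]] := first_def c; first exact: leq_addr.
have cK : c - m < K.
  rewrite ltnNge; apply: contraL not_full => Kc; rewrite -leqNgt.
  have [|<- _] := @rho_run F n t d _ _ (all_r m) a_r; first by rewrite -cat_nseqS.
  by rewrite -catA -nseqD mono // -leq_subRL // ltnW.
have grow_m y : m + y <= c -> rho (es ++ nseq m a) + y <= rho (es ++ nseq (m + y) a).
  elim: y => [|y IH] yc; first by rewrite !addn0.
  rewrite !addnS (leq_trans _ (grow _ _)) ?ltnS ?IH //; try lia.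
  by rewrite (leq_ltn_trans (mono _ c _)) //; lia.
have := grow_m (c - m); rewrite (subnKC (ltnW mc)) leqnn => /(_ isT).
have le2 : (c - m) * (M - 1) <= K * (K - 1).
  by rewrite leq_mul // ?leq_sub2r // ltnW.
have -> : c * M = m * M + (c - m) + (c - m) * (M - 1).
  by rewrite mulnBr muln1 -addnA subnKC ?leq_pmulr // -mulnDl subnKC // ltnW.
by rewrite mE; lia.
Qed.

(** If the form after the first [x < c] were deficient, [rho_run] would bound [N t] by [rho es + x *
    N (t - a) + K * (N (t - a) - 1)], against the hypothesis. *)
Lemma rho_expected es a c : all in_range es -> in_range a ->
  rho es + c * N (t - a) + K * (N (t - a) - 1) < N t ->
  rho (es ++ nseq c a) = rho es + c * N (t - a).
Proof.
set M := N (t - a) => es_r a_r small.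
have all_r x : all in_range (es ++ nseq x a).
  by rewrite all_cat es_r all_nseq a_r orbT.
suff H x : x <= c -> rho (es ++ nseq x a) = rho es + x * M by exact: H.
elim: x => [|x IH] xc; first by rewrite cats0 addn0.
have [] := @rho_rcons F n t (es ++ nseq x a) a.
  by rewrite -cat_nseqS; exact/in_range_le/all_r.
rewrite (IH (ltnW xc)) -cat_nseqS -/M => le _.
move: le; rewrite leq_eqVlt => /orP[/eqP ->|lt]; first by rewrite mulSn -addnA [M + _]addnC.
have [|_] := @rho_run F n t d _ _ (all_r x) a_r.
  by rewrite -cat_nseqS (IH (ltnW xc)).
rewrite (IH (ltnW xc)) -/M => le.
have : x * M <= c * M by rewrite leq_mul2r ltnW ?orbT.
by move: small le; set A := c * M; set B := x * M; set C := K * _; lia.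
Qed.

Variables (k : nat) (deg alpha : 'I_k -> nat).
Hypothesis deg_r : forall j, in_range (deg j).

Definition type_degs (s : seq 'I_k) := flatten [seq nseq (alpha j) (deg j) | j <- s].

Lemma type_degs_r s : all in_range (type_degs s).
Proof.
by elim: s => //= j s IH; rewrite all_cat IH all_nseq deg_r orbT.
Qed.

Lemma type_degs_rcons s j :
  type_degs (rcons s j) = type_degs s ++ nseq (alpha j) (deg j).
Proof. by rewrite /type_degs map_rcons flatten_rcons. Qed.

(** Each block of equal degrees loses at most [K * (K - 1)] by [rho_nseq], whose hypothesis passes
    to initial segments by monotonicity. *)
Lemma rho_type_degs s : rho (type_degs s) < N t ->
  \sum_(j <- s) alpha j * N (t - deg j) <= rho (type_degs s) + size s * (K * (K - 1)).
Proof.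
elim/last_ind: s => [|s j IH]; first by rewrite big_nil.
rewrite type_degs_rcons -cats1 big_cat big_seq1 size_cat addn1 mulSn => lt.
have := rho_nseq (type_degs_r s) (deg_r j) lt.
have /IH : rho (type_degs s) < N t by exact: leq_ltn_trans (rho_cat _ _ _ _ _) lt.
move: (K * (K - 1)) => Z le1 le2 /=; lia.
Qed.

Lemma sum_take_enum (f : 'I_k -> nat) (i : 'I_k) :
  \sum_(j <- take i.+1 (enum 'I_k)) f j = \sum_(j < k | j <= i) f j.
Proof.
rewrite (big_nth i) size_takel ?size_enum_ord ?ltn_ord //.
rewrite big_mkord (big_ord_widen _ (fun l => f (nth i (take i.+1 (enum 'I_k)) l)) (ltn_ord i)).
by apply: eq_bigr => j ji; rewrite nth_take // nth_ord_enum.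
Qed.

(** The inequality of index [i] is what [rho_expected] needs for the [i]-th block, once the earlier
    blocks have the expected dimension. *)
Lemma rho_type_degs_expected :
  (forall i : 'I_k, \sum_(j < k | j <= i) alpha j * N (t - deg j) +
     K * (N (t - deg i) - 1) < N t) ->
  rho (type_degs (enum 'I_k)) = \sum_(j < k) alpha j * N (t - deg j).
Proof.
move=> small; rewrite -[RHS]big_enum /=.
suff H i : i <= k -> rho (type_degs (take i (enum 'I_k))) =
    \sum_(j <- take i (enum 'I_k)) alpha j * N (t - deg j).
  by have := H k (leqnn k); rewrite take_oversize // size_enum_ord.
elim: i => [|i IH] ik; first by rewrite take0 rho_nil big_nil.
have tkE : take i.+1 (enum 'I_k) = rcons (take i (enum 'I_k)) (Ordinal ik).
  rewrite (take_nth (Ordinal ik)) ?size_enum_ord //; congr rcons.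
  by apply: val_inj; rewrite /= nth_enum_ord.
have := small (Ordinal ik); rewrite -(sum_take_enum _ (Ordinal ik)) tkE.
rewrite type_degs_rcons -cats1 big_cat big_seq1 /= -(IH (ltnW ik)).
exact/rho_expected/deg_r/type_degs_r.
Qed.

End Expected.

Local Open Scope ring_scope.

(** * Graded components of ideals *)

Section Component.
Variables (F : numFieldType) (n : nat).
Local Notation S := (dhomog n.+1 F).

(** Only the part of [g] of degree [t - a] reaches degree [t]. This replaces arbitrary coefficients
    of an ideal member by homogeneous ones. *)
Lemma hproj_mul t a (g h : {mpoly F[n.+1]}) : (a <= t)%N -> h \is (a).-homog ->
  hproj t (g * h) = hproj t (val (hproj (t - a) g) * h).
Proof.
move=> at_ hh; elim/mpolyind: g => [|c m p _ _ IH].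
  by rewrite linear0 !mul0r.
have -> : val (hproj (t - a) (c *: 'X_[m] + p)) =
    c *: val (hproj (t - a) 'X_[m]) + val (hproj (t - a) p) by rewrite linearP.
rewrite !mulrDl -!scalerAl !linearP /= IH; congr (c *: _ + _); apply: val_inj => /=.
have hm := dhomog_monomial F m.
have [dm|dm] := eqVneq (mdeg m) (t - a)%N.
  by rewrite (pihomog_dE (d := t - a)) // -dm.
rewrite (pihomog_ne0 dm hm) mul0r linear0.
apply: (pihomog_ne0 _ (dhomogM hm hh)); apply: contraNneq dm => <-.
by rewrite addnK.
Qed.

(** Forms of degree [t + s] are spanned by products [u * v] with [u] of degree [t], and a
    representation of [u] can be multiplied by [v]. *)
Lemma span_mul_full t s (e : nat -> nat) (h : nat -> {mpoly F[n.+1]}) m :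
    (forall i, (i < m)%N -> (e i <= t)%N) -> forms_of e h ->
  span_mul t e h m = fullv -> span_mul (t + s) e h m = fullv.
Proof.
move=> et hh full; apply/eqP; rewrite eqEsubv subvf; apply/subvP => p _.
rewrite -(hproj_val p); move: (val p) (dhomog_is_dhomog p).
apply: dhomogD_ind => [|c u v uV vV|u v hu hv].
- by rewrite linear0 mem0v.
- by rewrite linearP memvD ?memvZ.
have : hproj t u \in span_mul t e h m by rewrite full memvf.
move=> /(span_mulP _ et hh)[g hg]; rewrite hprojK // => ->.
rewrite mulr_suml linear_sum; apply: memv_suml => i _.
have hgv : g i * v \is (t + s - e i).-homog.
  by rewrite -addnBAC ?et //; exact: dhomogM.
have := span_mul_mem h (hproj (t + s - e i) (g i * v)) (ltn_ord i).
by rewrite mulpE hprojK // mulrAC.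
Qed.

Variables (J : finType) (e : J -> nat) (js : seq J).
Hypotheses (js_uniq : uniq js) (js_all : js =i J).

Lemma component_span_mul t (f : forms F n.+1 e) :
    all (fun a => a <= t)%N [seq e j | j <- js] ->
  component (ideal (fun j => f j : {mpoly F[n.+1]})) t =
  span_mul t (nth 0%N [seq e j | j <- js]) (form_seq js f) (size js).
Proof.
move=> /allP et.
have {}et i : (i < size js)%N -> (nth 0%N [seq e j | j <- js] i <= t)%N.
  by move=> im; rewrite et // mem_nth // size_map.
have sumE (g : J -> {mpoly F[n.+1]}) : \sum_j g j * val (f j) =
    \sum_(i < size js) nth 0 [seq g j | j <- js] i * form_seq js f i.
  rewrite (eq_bigl (fun j => j \in js)) => [|j]; last by rewrite js_all.
  rewrite -big_uniq //=; have [j0 _|js0] := pickP J; last first.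
    by case: js => [|j ?]; [rewrite big_nil big_ord0 | have := js0 j].
  rewrite (big_nth j0) big_mkord; apply: eq_bigr => i _.
  by rewrite (nth_map j0) // /form_seq (nth_map j0 0 (fun j => val (f j))).
apply/vspaceP => p; apply/idP/idP => [/mem_component[g]|pV]; last first.
  apply/mem_component; move: pV => /(span_mulP _ et (form_seq_homog js f))[g hg pE].
  exists (fun j => g (index j js)); rewrite sumE pE; apply: eq_bigr => i _.
  pose j0 := tnth (in_tuple js) i.
  by rewrite (nth_map j0) // index_uniq.
rewrite sumE => pE; rewrite -[p]hproj_val [val p]pE linear_sum /=.
apply: memv_suml => i _; rewrite (hproj_mul _ (et i _) (form_seq_homog js f i)) //.
by rewrite -mulpE; exact: span_mul_mem.
Qed.

End Component.

Local Close Scope ring_scope.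
Local Open Scope nat_scope.

(** * Listing the forms of a given type by blocks *)

Section TypeEnum.
Variables (k : nat) (d alpha : 'I_k -> nat).

Definition type_enum : seq (type_index alpha) :=
  [seq Tagged (fun i => 'I_(alpha i)) x | i <- enum 'I_k, x <- enum 'I_(alpha i)].

Lemma type_enum_uniq : uniq type_enum.
Proof.
apply: allpairs_uniq_dep => [|i _|]; rewrite ?enum_uniq //.
by move=> [i x] [j y] _ _.
Qed.

Lemma mem_type_enum : type_enum =i type_index alpha.
Proof.
by case=> i x; rewrite inE; apply: allpairs_f_dep; rewrite mem_enum.
Qed.

Lemma map_type_enum :
  [seq type_deg d s | s <- type_enum] = type_degs d alpha (enum 'I_k).
Proof.
rewrite /type_degs map_allpairs; congr flatten; apply: eq_map => i /=.
apply: (@eq_from_nth _ 0); rewrite size_map size_enum_ord ?size_nseq // => j ja.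
by rewrite nth_nseq ja (nth_map (Ordinal ja)) ?size_enum_ord.
Qed.

Lemma size_type_enum : size type_enum = \sum_(i < k) alpha i.
Proof.
rewrite size_allpairs_dep sumnE big_map big_enum; apply: eq_bigr => i _.
by rewrite size_enum_ord.
Qed.

End TypeEnum.

(** One open set has to serve all [l] at once. It is the nonvanishing locus of a single polynomial
    that ensures maximal rank in finitely many degrees. *)
Theorem general_hilbert (F : numFieldType) (n k : nat) (d alpha : 'I_k.+1 -> nat)
    (d_mono : forall i j : 'I_k.+1, i <= j -> d i <= d j) :
  general (fun f : forms F n.+1 (type_deg d (alpha := alpha)) =>
    let I := ideal (fun s => f s : {mpoly F[n.+1]}) in
    let N := Ndim n.+1 in
    forall l : nat, 0 < l ->
    let small := forall i : 'I_k.+1,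
      \sum_(j < k.+1 | j <= i) alpha j * N (l + (d ord_max - d j))
        + N (l + (d ord_max - d ord0)) * (N (l + (d ord_max - d i)) - 1)
      < N (l + d ord_max) in
    (small ->
       hilbert I (d ord_max + l) =
       \sum_(j < k.+1) alpha j * N (l + (d ord_max - d j)))
    /\
    (\sum_(j < k.+1) alpha j * N (l + (d ord_max - d j)) >
         N (l + d ord_max)
         + k.+1 * (N (l + (d ord_max - d ord0))
                   * (N (l + (d ord_max - d ord0)) - 1)) ->
       component I (d ord_max + l) = fullv)).
Proof.
pose N := Ndim n.+1; pose D := d ord_max; pose js := type_enum alpha.
pose e := type_deg d (alpha := alpha).
have dD j : d j <= D by apply: d_mono; rewrite -ltnS.
have d0d j : d ord0 <= d j by apply: d_mono.
have NE l j : N (l + (D - d j)) = N (D + l - d j) by rewrite addnBA ?dD // addnC.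
have d_r l j : d ord0 <= d j <= D + l by rewrite d0d (leq_trans (dD j)) ?leq_addr.
have e_le l : all (fun a => a <= D + l) [seq e j | j <- js].
  by apply/allP => _ /mapP[j _ ->]; case/andP: (d_r l (tag j)).
pose big l := N (l + D) + k.+1 * (N (l + (D - d ord0)) * (N (l + (D - d ord0)) - 1)) <
  \sum_(j < k.+1) alpha j * N (l + (D - d j)).
(* Only finitely many degrees impose conditions on [f]: the inequalities [small]
   force [l <= d ord0] unless [n = 0], and if the component of degree [D + l0]
   is full, then so are those of higher degree. *)
have [l0 l0_min] : exists l0, forall l, 0 < l -> big l -> [/\ big l0, l0 <= l & 0 < l0].
  have [ex|no] := pselect (exists l, (0 < l) && big l).
    have [l0 /andP[l00 bl0] l0m] := ex_minnP ex.
    by exists l0 => l' l'0 bl'; rewrite l0m // l'0.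
  by exists 0 => l lp bl; case: no; exists l; rewrite lp.
(* [l0] reaches the first full degree of the second claim; [d ord0] bounds the [l] of the first
   claim when [n > 0]. *)
pose T := D + maxn l0 (d ord0).
pose s := [seq (t, m) | t <- iota 0 T.+1, m <- iota 0 (size js).+1].
have [|P [f0 [Pf0 Pmax]]] := @max_rank_open F n _ e js (type_enum_uniq alpha) s.
  by apply/allP => _ /allpairsP[q [_ + ->]]; rewrite mem_iota.
exists [set f | P.@[coefs f] != 0%R]%classic; split.
- exists [set P]%classic; apply/seteqP; split=> f /=.
    by move=> /negP/negPn/eqP Pf Q ->.
  by move=> /(_ P erefl) ->; rewrite eqxx.
- by exists f0.
move=> f Pf I N' l l_gt0 small.
have cE u := component_span_mul (type_enum_uniq alpha) (@mem_type_enum _ alpha) f (e_le u).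
have rankE u : u <= maxn l0 (d ord0) ->
    \dim (component I (D + u)) = rho F n (D + u) (type_degs d alpha (enum 'I_k.+1)).
  move=> uT; rewrite (component_span_mul (type_enum_uniq alpha) (@mem_type_enum _ alpha) f (e_le u)).
  rewrite rhoE ?size_map //; first by rewrite take_oversize ?size_map // map_type_enum.
    exact: form_seq_homog.
  have := Pmax f Pf (D + u, size js); apply.
  by apply: allpairs_f; rewrite mem_iota add0n ltnS ?leq_add2l /=.
have smallE : small -> forall i : 'I_k.+1,
    \sum_(j < k.+1 | j <= i) alpha j * N (D + l - d j) +
      N (D + l - d ord0) * (N (D + l - d i) - 1) < N (D + l).
  move=> sm i; have : \sum_(j < k.+1 | j <= i) alpha j * N (l + (D - d j)) +
      N (l + (D - d ord0)) * (N (l + (D - d i)) - 1) < N (l + D) by exact: sm.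
  rewrite !NE [l + D]addnC.
  by under eq_bigr => j _ do rewrite NE.
split=> [sm|bl].
  transitivity (\sum_(j < k.+1) alpha j * N (D + l - d j)); last first.
    by apply: eq_bigr => j _; rewrite -NE.
  (* In one variable all the dimensions are 1, and the last inequality leaves no forms at all. *)
  have [n0|n_gt0] := posnP n.
    have N1 u : N u = 1 by rewrite /N Ndim_bin n0 bin0.
    have /eqP S0 : \sum_(j < k.+1) alpha j == 0.
      rewrite -leqn0 -ltnS; have := smallE sm ord_max; rewrite !N1 muln0 addn0.
      apply: leq_ltn_trans; rewrite [X in _ <= X]big_mkcond; apply: leq_sum => j _.
      by rewrite N1 muln1 leq_ord.
    under eq_bigr do rewrite N1 muln1.
    rewrite S0 /hilbert cE size_type_enum S0 /span_mul big_ord0; exact: dimv0.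
  (* With K the dimension in degree [D + l - d ord0], the last inequality and [Ndim_add] give [K *
     (N l - 1) < N (D + l) <= K * N (d ord0)], so [N l <= N (d ord0)], and [N] is strictly
     increasing. *)
  have ld : l <= d ord0.
    rewrite leqNgt; apply/negP => /(Ndim_lt n_gt0); apply/negP; rewrite -leqNgt.
    have := smallE sm ord_max; have := Ndim_add n (D + l - d ord0) (d ord0).
    rewrite subnK; last by case/andP: (d_r l ord0).
    rewrite -/D [D + l - D]addKn => le1 /(leq_ltn_trans (leq_addl _ _)).
    move=> /leq_trans/(_ le1); rewrite ltn_mul2l => /andP[_].
    by rewrite /N; have := Ndim_gt0 n l; lia.
  rewrite /hilbert rankE ?leq_max ?ld ?orbT //.
  rewrite (rho_type_degs_expected F (d_r l)) //; exact: smallE.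
have [bl0 l0l l00] := l0_min l l_gt0 bl.
(* Otherwise [rho_type_degs] and [rho_le] would contradict [big l0]. *)
have full0 : component I (D + l0) = fullv.
  apply/eqP; rewrite eqEdim subvf dim_hom rankE ?leq_max ?leqnn //= leqNgt.
  apply/negP => /(rho_type_degs (d_r l0)); apply/negP; rewrite -ltnNge.
  apply: leq_ltn_trans (leq_trans bl0 _).
    rewrite size_enum_ord !NE [l0 + D]addnC leq_add2r; exact: rho_le.
  by rewrite big_enum; apply: leq_sum => j _; rewrite NE.
rewrite -(subnKC l0l) addnA.
rewrite /I -addnA subnKC // cE -(subnKC l0l) addnA; apply: span_mul_full.
- move=> i im; have /allP := e_le l0; apply; by rewrite mem_nth ?size_map.
- exact: form_seq_homog.
- by rewrite -cE.
Qed.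

(* The numbers of variables and of degrees are n.+1 and k.+1, so that
   d_1 = d ord0 and d_k = d ord_max. *)
Theorem theorem4p1 (R : realType) (n k : nat) (d alpha : 'I_k.+1 -> nat)
    (d_gt0 : forall i : 'I_k.+1, 0 < d i)
    (d_mono : forall i j : 'I_k.+1, i <= j -> d i <= d j) :
  general (fun f : forms R[i] n.+1 (type_deg d (alpha := alpha)) =>
    let I := ideal (fun s => f s : {mpoly R[i][n.+1]}) in
    let N := Ndim n.+1 in
    forall l : nat, 0 < l ->
    let small := forall i : 'I_k.+1,
      \sum_(j < k.+1 | j <= i) alpha j * N (l + (d ord_max - d j))
        + N (l + (d ord_max - d ord0)) * (N (l + (d ord_max - d i)) - 1)
      < N (l + d ord_max) in
    (small ->
       hilbert I (d ord_max + l) =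
       \sum_(j < k.+1) alpha j * N (l + (d ord_max - d j)))
    /\
    (~ small ->
       \sum_(j < k.+1) alpha j * N (l + (d ord_max - d j)) >
         N (l + d ord_max)
         + k.+1 * (N (l + (d ord_max - d ord0))
                   * (N (l + (d ord_max - d ord0)) - 1)) ->
       component I (d ord_max + l) = fullv)).
Proof.
have [U [oU neU sub]] := general_hilbert R[i] n alpha d_mono.
exists U; split=> // f /sub H I N l l_gt0 small.
by have [small_eq big_eq] := H l l_gt0; split=> // _; exact: big_eq.
Qed.
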